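(* Let $L$ be a Linnik constant. Then there is a constant $C>0$ (depending only on $L$) such that: (i) for every positive integer $n$ there exists a positive integer $m\le C n^{2L+1}$ with $d(m)=f(m)=n$; (ii) for every positive integer $n$ there exists a positive integer $m\le C n^{6L+3}$ with $d(m)/f(m)=n$; (iii) for all positive integers $a,b$ with $a\mid b$ and $\gcd\big(b/a,\ a\,\varphi(\mathrm{rad}(b))\big)=1$, there exists a positive integer $m\le C b^{2L+2}/a$ with $f(m)=a$ and $d(m)=b$.
   Context: For a positive integer $m$, let $\varphi(m)$ be Euler's function and $\lambda(m)$ the Carmichael function (the exponent of the multiplicative group $(\mathbb{Z}/m\mathbb{Z})^*$). Let $\mathrm{rad}(m)$ be the product of the distinct primes dividing $m$. Let $\delta=2$ if $4\mid m$ and $\delta=1$ otherwise. Define $$ d(m)=\gcd\big(m,\ \delta\,\varphi(\mathrm{rad}(m))\big),\qquad f(m)=\gcd\big(m,\ \delta\,\lambda(m)\varphi(\mathrm{rad}(m))/\varphi(m)\big). $$ A Linnik constant is a positive number $L$ such that there is an absolute constant $c>0$ with the property that for all integers $1\le a<q$ with $\gcd(a,q)=1$, the smallest prime $p(a,q)$ in the progression $\{a+jq: j\ge 0\}$ satisfies $p(a,q)\le c\, q^L$ (such $L$ exist by Linnik's theorem; e.g. $L=5$ works). *)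

(* Defs.v *)
From Stdlib Require Import Reals.
From mathcomp Require Import all_boot.

Definition rad (m : nat) : nat := \prod_(p <- primes m) p.

(* Carmichael function: exponent of (Z/mZ)^*, i.e. the least k >= 1 with
   a^k = 1 (mod m) for every a coprime to m.  The search over 1..m suffices
   since lambda(m) <= phi(m) <= m (for m >= 1). *)
Definition carm_prop (m k : nat) : bool :=
  [forall a : 'I_m, coprime a m ==> (a ^ k %% m == 1 %% m)].
Definition carmichael (m : nat) : nat :=
  head 0 [seq k <- iota 1 m | carm_prop m k].

Definition delta (m : nat) : nat := if 4 %| m then 2 else 1.

Definition dfun (m : nat) : nat := gcdn m (delta m * totient (rad m)).

(* delta * lambda(m) * phi(rad m) is divisible by phi(m); exact division *)
Definition ffun (m : nat) : nat :=
  gcdn m ((delta m * carmichael m * totient (rad m)) %/ totient m).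

Definition linnik_constant (L : R) : Prop :=
  Rlt 0 L /\
  exists c : R, Rlt 0 c /\
    forall a q : nat, 1 <= a -> a < q -> coprime a q ->
      exists p j : nat, prime p /\ p = a + j * q /\
        Rle (INR p) (Rmult c (Rpower (INR q) L)).

(* Main.v *)
Require Import Defs.
From Stdlib Require Import Reals Lra.
From mathcomp Require Import all_boot ssralg finalg zmodp poly cyclic zify.

(** Every m is sought in the form K * q with q a prime not dividing K, taken
    from Linnik's bound.  Since phi(m) = phi(rad m) * (m / rad m), the second
    argument of the gcd defining f(m) is delta * lambda(m) / (K / rad K).  A
    primitive root mod q shows that q - 1 divides lambda(m), while lambda(m)
    divides (q - 1) * z as soon as (q - 1) * z kills (Z/KZ)^*.  So it suffices
    to prescribe the exact valuations of q - 1 at the primes of K, that is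
    q - 1 = T * u with u coprime to a given divisor of T:
    - for f = a and d = a * k with k odd: K = a * k * rad k and T = a^2 * k
      (part (i) is the case k = 1);
    - if k = b / a is even, coprimality forces a = 1 and b = 2^j: m = 8 when
      j = 1, otherwise K = 2^(j+1) and T = 2^(j-1), using that
      lambda(2^(j+1)) divides 2^(j-1);
    - for d = n * f: let D be the largest divisor of phi(rad n) composed of
      primes dividing n, W = n * D, K = n * W and T = n * W^2 / (e * rad n),
      with e = gcd(n, 2), so that d = K and f = W.  The factor D makes the
      valuations of q - 1 dominate those of phi(K). *)

(** * The radical and its relation to Euler's function *)

Lemma prod_primes_gt0 (s : seq nat) : all prime s -> 0 < \prod_(p <- s) p.
Proof.
elim: s => [|p s IH]; rewrite ?big_nil // big_cons => /andP[pp ps].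
by rewrite muln_gt0 prime_gt0 // IH.
Qed.

Lemma primes_all_prime m : all prime (primes m).
Proof. by apply/allP => p; rewrite mem_primes => /and3P[]. Qed.

Lemma rad_gt0 m : 0 < rad m.
Proof. exact/prod_primes_gt0/primes_all_prime. Qed.

Lemma logn_prod_primes p (s : seq nat) : prime p -> all prime s -> uniq s ->
  logn p (\prod_(r <- s) r) = (p \in s).
Proof.
move=> pp; elim: s => [|r s IH]; first by rewrite big_nil logn1.
rewrite big_cons /= => /andP[pr ps] /andP[rs us].
rewrite lognM ?prod_primes_gt0 ?prime_gt0 // IH // logn_prime // in_cons eq_sym.
by case: eqP => // <-; rewrite (negPf rs).
Qed.

Lemma logn_rad p m : logn p (rad m) = (p \in primes m).
Proof.
have [pp|npp] := boolP (prime p).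
  by rewrite logn_prod_primes ?primes_all_prime ?primes_uniq.
by rewrite mem_primes (negPf npp) lognE (negPf npp).
Qed.

Lemma primes_rad m : primes (rad m) = primes m.
Proof.
apply/eq_primes => p; rewrite -[LHS]logn_gt0 logn_rad lt0b //.
Qed.

Lemma rad_dvd m : 0 < m -> rad m %| m.
Proof.
move=> m0; apply/dvdn_partP; first exact: rad_gt0.
move=> p; rewrite -[_ \in _]/(p \in primes (rad m)) mem_primes => /andP[pp _].
by rewrite p_part pfactor_dvdn // logn_rad -logn_gt0; case: (logn p m).
Qed.

Lemma eq_rad m n : primes m =i primes n -> rad m = rad n.
Proof. by move/eq_primes; rewrite /rad => ->. Qed.

Lemma radM m n : 0 < m -> 0 < n -> coprime m n -> rad (m * n) = rad m * rad n.
Proof.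
move=> m0 n0 cmn; apply/eqn_from_log; rewrite ?muln_gt0 ?rad_gt0 // => p.
rewrite lognM ?rad_gt0 // !logn_rad primesM //.
have [pm|] := boolP (p \in primes m) => //=.
have : ~~ has (mem (primes m)) (primes n).
  by rewrite has_sym -coprime_has_primes // coprime_sym.
by move=> /hasPn h; case: (boolP (p \in primes n)) => // /h /=; rewrite pm.
Qed.

Lemma rad_prime p : prime p -> rad p = p.
Proof. by move=> pp; rewrite /rad primes_prime // big_seq1. Qed.

Lemma totient_rad m : totient (rad m) = \prod_(p <- primes m) p.-1.
Proof.
rewrite totientE ?rad_gt0 // primes_rad big_seq [RHS]big_seq.
by apply: eq_bigr => p pm; rewrite logn_rad pm muln1.
Qed.

(** A prime p of exponent v in [m] contributes p - 1 to phi(rad m) and p^(v - 1) to m / rad m. *)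
Lemma totient_rad_div m : 0 < m ->
  totient m = totient (rad m) * (m %/ rad m).
Proof.
move=> m0; apply/eqP; rewrite -(eqn_pmul2r (rad_gt0 m)) -mulnA divnK ?rad_dvd //.
rewrite totient_rad totientE // big_split /= -mulnA; apply/eqP; congr (_ * _).
rewrite /rad -big_split /= [RHS](prod_prime_decomp m0) prime_decompE big_map.
rewrite big_seq [RHS]big_seq; apply: eq_bigr => p pm /=.
by rewrite -expnSr prednK // logn_gt0.
Qed.

Lemma pred_dvd_totient_rad p m : p \in primes m -> p.-1 %| totient (rad m).
Proof. by move=> pm; rewrite totient_rad (big_rem p) //= dvdn_mulr. Qed.

Lemma totient_leq m : totient m <= m.
Proof.
rewrite totient_count_coprime big_mkord.
apply: (@leq_trans (\sum_(i < m) 1)); last by rewrite sum1_card card_ord.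
by apply: leq_sum => i _; exact: leq_b1.
Qed.

(** * The Carmichael function, in general and at [K * q] *)

Lemma carm_propP m k : 0 < m ->
  reflect (forall a, coprime a m -> a ^ k = 1 %[mod m]) (carm_prop m k).
Proof.
move=> m0; apply: (iffP forallP) => [h a cam|h a].
  have := h (Ordinal (ltn_pmod a m0)); rewrite /= coprime_modl cam /= modnXm.
  by move/eqP.
by apply/implyP => cam; apply/eqP/h.
Qed.

Lemma carmichaelP m : 0 < m ->
  [/\ 0 < carmichael m, carm_prop m (carmichael m)
    & forall k, 0 < k -> carm_prop m k -> carmichael m <= k].
Proof.
move=> m0; rewrite /carmichael; set s := [seq _ <- _ | _].
have ms k : (k \in s) = carm_prop m k && (1 <= k <= m).
  by rewrite mem_filter mem_iota add1n ltnS.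
have sle : sorted leq s.
  by apply: sorted_filter; [exact: leq_trans | exact: iota_sorted].
(* Euler's theorem puts phi(m) in the search list, so [head] does not return its default 0. *)
have : totient m \in s.
  rewrite ms totient_gt0 m0 /=; apply/andP; split.
    by apply/carm_propP => // a; exact: Euler_exp_totient.
  exact: totient_leq.
case: s ms sle => // x s ms /= sle _.
have := ms x; rewrite mem_head => /esym/andP[cx /andP[x0 xm]]; split=> // k k0 ck.
have [km|mk] := leqP k m; last exact: leq_trans xm (ltnW mk).
have : k \in x :: s by rewrite ms ck k0.
rewrite in_cons => /orP[/eqP-> //|ks].
exact: (allP (order_path_min leq_trans sle)).
Qed.

(** The remainder of [k] modulo lambda(m) is again an exponent killing all units, so the minimality
    of lambda(m) forces it to be 0. *)
Lemma carmichael_dvd m k : 0 < m ->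
  (forall a, coprime a m -> a ^ k = 1 %[mod m]) -> carmichael m %| k.
Proof.
move=> m0 hk; have [l0 /(carm_propP _ _ m0) cl lmin] := carmichaelP m m0.
rewrite /dvdn; case: (posnP (k %% carmichael m)) => [_ //|r0].
have := ltn_pmod k l0; rewrite ltnNge lmin //.
apply/carm_propP => // a cam; set l := carmichael m in cl *.
have al : (a ^ l) ^ (k %/ l) = 1 %[mod m] by rewrite -modnXm cl // modnXm exp1n.
rewrite -(hk a cam) [in RHS](divn_eq k l) expnD [_ * l]mulnC expnM.
by rewrite -[RHS]modnMml al modnMml mul1n.
Qed.

(** The residues 1, ..., q - 1 are q - 1 distinct roots of X^(q - 1) - 1 in the field ['F_q], so one
    of them has order exactly q - 1. *)
Lemma exists_primitive_root q : prime q ->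
  exists2 g, coprime g q & forall k, g ^ k = 1 %[mod q] -> q.-1 %| k.
Proof.
move=> pq; have q1 := prime_gt1 pq.
pose rs := [seq (i%:R : 'F_q)%R | i <- iota 1 q.-1].
have : has q.-1.-primitive_root%R rs.
  apply: has_prim_root; rewrite ?size_map ?size_iota //; first by rewrite -subn1 subn_gt0.
    apply/allP => x /mapP[i]; rewrite mem_iota => /andP[i0 iq] ->.
    rewrite unity_rootE -GRing.natrX; apply/eqP/val_inj => /=.
    rewrite !val_Fp_nat // -totient_prime //.
    rewrite Euler_exp_totient ?modn_small // coprime_sym prime_coprime //.
    by rewrite gtnNdvd // -(prednK (ltnW q1)) -add1n.
  rewrite map_inj_in_uniq ?iota_uniq // => i j; rewrite !mem_iota.
  rewrite add1n prednK ?(ltnW q1) // => /andP[_ iq] /andP[_ jq] /(congr1 val) /=.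
  by rewrite !val_Fp_nat // !modn_small.
case/hasP => x /mapP[i]; rewrite mem_iota => /andP[i0 iq] -> prim.
exists i.
  rewrite coprime_sym prime_coprime // gtnNdvd // -(prednK (ltnW q1)) -add1n //.
move=> k ik; rewrite (prim_order_dvd prim) -GRing.natrX.
by apply/eqP/val_inj => /=; rewrite val_Fp_nat // ik modn_small.
Qed.

(** The Chinese remainder theorem lifts a primitive root mod [q] to a unit mod [K * q] that is 1 mod
    [K]. *)
Lemma pred_dvd_carmichael K q : prime q -> ~~ (q %| K) -> 0 < K ->
  q.-1 %| carmichael (K * q).
Proof.
move=> pq qK K0; have q0 := prime_gt0 pq.
have cKq : coprime K q by rewrite coprime_sym prime_coprime.
have [g gq gmin] := exists_primitive_root q pq.
pose x := chinese K q 1 g; apply: gmin.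
have xq : x = g %[mod q] by exact: chinese_modr.
have xK : x = 1 %[mod K] by exact: chinese_modl.
have m0 : 0 < K * q by rewrite muln_gt0 K0.
have [_ /(carm_propP _ _ m0) h _] := carmichaelP _ m0.
have /h : coprime x (K * q).
  rewrite coprimeMr -(coprime_modl x K) xK coprime_modl coprime1n.
  by rewrite -(coprime_modl x q) xq coprime_modl.
move/eqP; rewrite chinese_remainder // => /andP[_ /eqP <-].
by rewrite -[in RHS]modnXm xq modnXm.
Qed.

(** Fermat's theorem handles the modulus [q], the hypothesis handles [K], and the Chinese remainder
    theorem joins the two. *)
Lemma carmichael_mul_dvd K q z : prime q -> ~~ (q %| K) -> 0 < K ->
    (forall a, coprime a K -> a ^ (q.-1 * z) = 1 %[mod K]) ->
  carmichael (K * q) %| q.-1 * z.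
Proof.
move=> pq qK K0 h; have q0 := prime_gt0 pq.
have cKq : coprime K q by rewrite coprime_sym prime_coprime.
apply: carmichael_dvd; rewrite ?muln_gt0 ?K0 // => a.
rewrite coprimeMr => /andP[aK aq]; apply/eqP; rewrite chinese_remainder // h //.
rewrite eqxx /= expnM -modnXm -totient_prime // Euler_exp_totient // modnXm.
by rewrite exp1n.
Qed.

(** * Evaluation of d and f at [K * q] *)

Lemma coprime_prime_lt q x : prime q -> 0 < x < q -> coprime q x.
Proof. by move=> pq /andP[x0 xq]; rewrite prime_coprime // gtnNdvd. Qed.

(** The gcd is that of [g * (h * q)] and [g * s], whose cofactors are coprime. *)
Lemma dfun_eq K q g h s : prime q -> ~~ (q %| K) -> 0 < K -> K = g * h ->
    delta (K * q) * totient (rad K) * q.-1 = g * s -> coprime (h * q) s ->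
  dfun (K * q) = g.
Proof.
move=> pq qK K0 Kgh eqs hs.
have cKq : coprime K q by rewrite coprime_sym prime_coprime.
have cr : coprime (rad K) q by apply: coprime_dvdl cKq; exact: rad_dvd.
rewrite /dfun radM ?(prime_gt0 pq) // (rad_prime q) // totient_coprime // (totient_prime pq).
by rewrite mulnA eqs {1}Kgh -mulnA -muln_gcdr (eqP hs) muln1.
Qed.

(** Here lambda(K * q) = (q - 1) * y, where all that is known of y is that it divides [z].
    Coprimality with [s * z] covers every such y, so lambda need not be computed exactly. *)
Lemma ffun_eq K q g h s z : prime q -> ~~ (q %| K) -> 0 < K -> 0 < z ->
    K = g * h -> delta (K * q) * q.-1 = K %/ rad K * (g * s) ->
    (forall a, coprime a K -> a ^ (q.-1 * z) = 1 %[mod K]) ->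
    coprime (h * q) (s * z) ->
  ffun (K * q) = g.
Proof.
move=> pq qK K0 z0 Kgh eqs hz hs; have q0 := prime_gt0 pq.
have q1 : 0 < q.-1 by rewrite -subn1 subn_gt0 prime_gt1.
have cKq : coprime K q by rewrite coprime_sym prime_coprime.
have m0 : 0 < K * q by rewrite muln_gt0 K0.
have [y eqy] := dvdnP (pred_dvd_carmichael K q pq qK K0).
have yz : y %| z.
  have := carmichael_mul_dvd K q z pq qK K0 hz.
  by rewrite eqy mulnC dvdn_pmul2l.
have t0 : 0 < K %/ rad K by rewrite divn_gt0 ?rad_gt0 // dvdn_leq // rad_dvd.
have -> : ffun (K * q) = gcdn (g * h * q) (g * s * y).
  (* Cancelling phi(rad m) leaves delta * lambda(m) / (m / rad m), and m / rad m = K / rad K because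
     [q] is its own radical. *)
  rewrite /ffun (totient_rad_div (K * q)) // [X in X %/ _]mulnC divnMl ?totient_gt0 ?rad_gt0 //.
  rewrite radM // (rad_prime q) // divnMr // eqy mulnCA eqs mulnCA mulKn //.
  by rewrite Kgh [y * _]mulnC.
rewrite -!mulnA -muln_gcdr.
suff /eqP -> : coprime (h * q) (s * y) by rewrite muln1.
by apply: coprime_dvdr hs; rewrite dvdn_mul.
Qed.

(** * Values of d and f when q - 1 has a prescribed shape *)

Lemma delta_bounds m : 0 < delta m <= 2.
Proof. by rewrite /delta; case: ifP. Qed.

Lemma coprime_odd_delta k m : odd k -> coprime k (delta m).
Proof. by move=> ok; rewrite /delta; case: ifP; rewrite ?coprimen1 ?coprimen2. Qed.

Lemma expn_totient_dvd K e a : totient K %| e -> coprime a K ->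
  a ^ e = 1 %[mod K].
Proof.
move=> /dvdnP[x ->] caK.
by rewrite mulnC expnM -modnXm Euler_exp_totient // modnXm exp1n.
Qed.

Lemma dvdn_pred_lt q x : prime q -> x %| q.-1 -> x < q.
Proof.
move=> pq; have q1 := prime_gt1 pq => /dvdn_leq xq.
by rewrite -(prednK (ltnW q1)) ltnS xq // -subn1 subn_gt0.
Qed.

Lemma rad_leq m : 0 < m -> rad m <= m.
Proof. by move=> m0; rewrite dvdn_leq ?rad_dvd. Qed.

Lemma rad_mul_rad k : 0 < k -> rad (k * rad k) = rad k.
Proof.
by move=> k0; apply: eq_rad => p; rewrite primesM ?rad_gt0 // primes_rad orbb.
Qed.

(** At a prime of [k], both q - 1 and K / rad K have the valuation of [k]: it survives in d and
    cancels in f. At a prime of [a], the square in [a ^ 2] leaves a multiple of [a] after division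
    by K / rad K. *)
Lemma dfun_ffun_mul a k q u : prime q -> 2 < q -> 0 < a -> odd k ->
    coprime k (a * totient (rad (a * k))) ->
    q.-1 = a ^ 2 * k * u -> coprime k u ->
  dfun (a * (k * rad k) * q) = a * k /\ ffun (a * (k * rad k) * q) = a.
Proof.
move=> pq q2 a0 ok; rewrite coprimeMr => /andP[cka ckt] eq_q cku.
have k0 : 0 < k by case: (k) ok.
have u0 : 0 < u by case: (u) eq_q; lia.
have r0 := rad_gt0 k; have ra0 := rad_gt0 a.
(* Divisors of q - 1 are smaller than the prime [q], hence coprime to it, and so are their radicals
   and totients. *)
have aq : a < q.
  by apply: (dvdn_pred_lt q _ pq); rewrite eq_q -mulnA expnS -mulnA dvdn_mulr.
have kq : k < q by apply: (dvdn_pred_lt q _ pq); rewrite eq_q mulnAC dvdn_mull.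
have uq : u < q by apply: (dvdn_pred_lt q _ pq); rewrite eq_q dvdn_mull.
have rk := rad_leq _ k0; have rka := rad_leq _ a0.
have cqa : coprime q a by rewrite coprime_prime_lt ?a0.
have cqk : coprime q k by rewrite coprime_prime_lt ?k0.
have cqr : coprime q (rad k) by rewrite coprime_prime_lt ?r0 ?(leq_ltn_trans rk).
have cqra : coprime q (rad a) by rewrite coprime_prime_lt ?ra0 ?(leq_ltn_trans rka).
have cqu : coprime q u by rewrite coprime_prime_lt ?u0.
have cqt x : 0 < x < q -> coprime q (totient x).
  case/andP=> x0 xq; rewrite coprime_prime_lt // totient_gt0 x0.
  exact: leq_ltn_trans (totient_leq x) xq.
have cqtra : coprime q (totient (rad a)) by rewrite cqt ?ra0 ?(leq_ltn_trans rka).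
have cqtrk : coprime q (totient (rad k)) by rewrite cqt ?r0 ?(leq_ltn_trans rk).
have cqd m : coprime q (delta m).
  by case/andP: (delta_bounds m) => d0 d2; rewrite coprime_prime_lt ?d0 ?(leq_ltn_trans d2).
have ckra : coprime k (rad a) by apply: coprime_dvdr cka; exact: rad_dvd.
have crr : coprime (rad a) (rad k).
  by rewrite coprime_sym; apply: coprime_dvdl ckra; exact: rad_dvd.
have cak : coprime a (k * rad k).
  rewrite coprimeMr coprime_sym cka coprime_sym.
  by apply: coprime_dvdl cka; exact: rad_dvd.
have radak : rad (a * k) = rad a * rad k by rewrite radM // coprime_sym.
move: ckt; rewrite radak totient_coprime // coprimeMr => /andP[ckta cktk].
set K := a * (k * rad k).
have K0 : 0 < K by rewrite !muln_gt0 a0 k0.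
have qK : ~~ (q %| K) by rewrite -prime_coprime // !coprimeMr cqa cqk.
have radK : rad K = rad a * rad k by rewrite radM ?rad_mul_rad ?muln_gt0 ?k0.
have KrK : K %/ rad K = a %/ rad a * k.
  rewrite radK {1}/K mulnA divnMr // -{1}(divnK (rad_dvd _ a0)).
  by rewrite mulnAC mulnK.
have crad x : coprime k x -> coprime (rad k) x.
  by apply: coprime_dvdl; exact: rad_dvd.
have ckd m := coprime_odd_delta k m ok.
split.
  apply: (@dfun_eq _ _ _ (rad k)
    (delta (K * q) * (totient (rad a) * totient (rad k)) * (a * u))) => //.
  - by rewrite /K mulnA.
  - by rewrite radK totient_coprime // eq_q; lia.
  rewrite coprimeMl; apply/andP; split; first apply: crad.
    by rewrite !coprimeMr ckd ckta cktk cka.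
  by rewrite !coprimeMr cqd cqa cqu cqtra cqtrk.
have ckaa : coprime k (a %/ rad a).
  by apply: coprime_dvdr cka; apply/dvdnP; exists (rad a); rewrite mulnC divnK // rad_dvd.
(* phi(K) = phi(a) * phi(rad k) * k, and [k] already divides q - 1, so z supplies only the other two
   factors. *)
apply: (@ffun_eq _ _ _ (k * rad k) (rad a * delta (K * q) * u)
          (totient a * totient (rad k))) => //.
- by rewrite muln_gt0 !totient_gt0 a0.
- have Ea : a * a = a %/ rad a * rad a * a by rewrite divnK ?rad_dvd.
  by rewrite KrK eq_q -mulnn Ea; lia.
- move=> b; apply: expn_totient_dvd; rewrite totient_coprime //.
  rewrite [totient (k * _)]totient_rad_div ?muln_gt0 ?k0 // rad_mul_rad // mulnK //.
  by rewrite eq_q; apply/dvdnP; exists (a ^ 2 * u); lia.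
have cz : coprime k (rad a * delta (K * q) * u * (totient a * totient (rad k))).
  rewrite !coprimeMr ckra ckd cku cktk (totient_rad_div a) // coprimeMr ckta.
  by rewrite ckaa.
rewrite !coprimeMl cz crad //= !coprimeMr cqra cqd cqu cqtrk.
by rewrite cqt ?a0.
Qed.

(** If a = 2h + 1 then a^2 - 1 = 4h(h + 1) is a multiple of 8; each further squaring multiplies x -
    1 by the even number x + 1. *)
Lemma expn_odd_mod2 i a : odd a -> a ^ 2 ^ i.+1 = 1 %[mod 2 ^ i.+3].
Proof.
move=> oa; have a0 : 0 < a by case: (a) oa.
apply/eqP; rewrite eqn_mod_dvd ?expn_gt0 ?a0 //.
elim: i => [|i IH].
  rewrite -[a](odd_double_half a) oa.
  have -> : (true + a./2.*2) ^ 2 ^ 1 - 1 = 4 * (a./2 * a./2.+1).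
    by rewrite -!muln2 expn1 /=; nia.
  rewrite -[2 ^ 3]/(4 * 2) dvdn_pmul2l // dvdn2 oddM /=; by case: odd.
have -> : a ^ 2 ^ i.+2 - 1 = (a ^ 2 ^ i.+1 - 1) * (a ^ 2 ^ i.+1 + 1).
  by rewrite [2 ^ i.+2]expnSr expnM -[in LHS](exp1n 2) subn_sqr.
rewrite [2 ^ i.+4]expnSr dvdn_mul // dvdn2 addn1 /= negbK oddX oa orbT //.
Qed.

(** With delta = 2, the 2-part of delta * (q - 1) is [2 ^ i.+2], which is also K / rad K: it gives d
    and cancels in f. *)
Lemma dfun_ffun_pow2 i q u : prime q -> odd u -> q.-1 = 2 ^ i.+1 * u ->
  dfun (2 ^ i.+3 * q) = 2 ^ i.+2 /\ ffun (2 ^ i.+3 * q) = 1.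
Proof.
move=> pq ou eq_q; have u0 : 0 < u by case: (u) ou.
have e0 : 0 < 2 ^ i by rewrite expn_gt0.
have q2 : 2 < q by apply: (dvdn_pred_lt q _ pq); rewrite eq_q expnS -mulnA dvdn_mulr.
have uq : u < q by apply: (dvdn_pred_lt q _ pq); rewrite eq_q dvdn_mull.
have oq : coprime q 2 by rewrite coprime_prime_lt.
have qK : ~~ (q %| 2 ^ i.+3) by rewrite -prime_coprime // coprimeXr.
have K0 : 0 < 2 ^ i.+3 by rewrite expn_gt0.
have radK : rad (2 ^ i.+3) = 2 by rewrite /rad primesX // big_seq1.
have dK : delta (2 ^ i.+3 * q) = 2 by rewrite /delta dvdn_mulr // -[4]/(2 ^ 2) dvdn_exp2l.
have cqu : coprime q u by rewrite coprime_prime_lt ?u0.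
have c2u : coprime 2 u by rewrite coprime2n.
split.
  apply: (@dfun_eq _ _ _ 2 u) => //; first by rewrite [LHS]expnSr.
    by rewrite radK dK eq_q [2 ^ i.+2]expnS mulnA.
  by rewrite coprimeMl c2u.
(* The exponent q - 1 already kills the units mod [2 ^ i.+3], so z = 1. *)
apply: (@ffun_eq _ _ _ (2 ^ i.+3) u 1) => //.
- by rewrite mul1n.
- by rewrite radK dK eq_q mulnA [2 ^ i.+3]expnSr mulnK // mul1n [2 ^ i.+2]expnS.
- move=> a; rewrite coprime_sym coprime_pexpl // coprime2n => oa.
  by rewrite muln1 eq_q expnM -modnXm expn_odd_mod2 // modnXm exp1n.
by rewrite muln1 coprimeMl coprimeXl.
Qed.

(** Dividing delta * (q - 1) by K / rad K leaves [n * D * u], whence f = n * D, whereas the product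
    of delta * (q - 1) and phi(rad n) is a multiple of K, whence d = K. *)
Lemma dfun_eq_mul_ffun n q u (D := (totient (rad n))`_\pi(n))
    (e := if odd n then 1 else 2) : prime q -> 1 < n ->
    q.-1 = n * (n %/ e) * (n %/ rad n) * D ^ 2 * u -> coprime n u ->
  dfun (n * (n * D) * q) = n * ffun (n * (n * D) * q).
Proof.
move=> pq n1 eq_q cnu; have n0 := ltnW n1.
have r0 := rad_gt0 n.
have t0 : 0 < totient (rad n) by rewrite totient_gt0.
have D0 : 0 < D by exact: part_gt0.
have en : e %| n by rewrite /e; case: ifP => // /negbT; rewrite dvdn2.
have ne0 : 0 < n %/ e by rewrite divn_gt0 ?(dvdn_leq n0) // /e; case: ifP.
have nr0 : 0 < n %/ rad n by rewrite divn_gt0 ?(dvdn_leq n0) ?rad_dvd.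
have u0 : 0 < u by have := prime_gt1 pq; case: (u) eq_q; lia.
have DD0 : 0 < D ^ 2 by rewrite expn_gt0 D0.
have rn := rad_leq _ n0; have tr := totient_leq (rad n).
have nq : n < q by apply: (dvdn_pred_lt q _ pq); rewrite eq_q -!mulnA dvdn_mulr.
have uq : u < q by apply: (dvdn_pred_lt q _ pq); rewrite eq_q dvdn_mull.
have q2 : 2 < q by exact: leq_ltn_trans nq.
have tq : totient (rad n) < q by lia.
have Dq : D < q by apply: leq_ltn_trans tq; rewrite dvdn_leq ?dvdn_part.
have nrq : n %/ rad n < q by apply: leq_ltn_trans nq; exact: leq_div.
have cqn : coprime q n by rewrite coprime_prime_lt ?n0.
have cqD : coprime q D by rewrite coprime_prime_lt ?D0.
have cqu : coprime q u by rewrite coprime_prime_lt ?u0.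
have cqr : coprime q (n %/ rad n) by rewrite coprime_prime_lt ?nr0.
have cqt : coprime q (totient (rad n)) by rewrite coprime_prime_lt ?t0.
pose D' := (totient (rad n))`_\pi(n)^'.
have DD' : D * D' = totient (rad n) by exact: partnC.
have D'0 : 0 < D' by exact: part_gt0.
have cnD' : coprime n D' by rewrite coprime_pi' // part_pnat.
have cqD' : coprime q D' by apply: coprime_dvdr cqt; rewrite dvdn_part.
set K := n * (n * D).
have K0 : 0 < K by rewrite !muln_gt0 n0.
have qK : ~~ (q %| K) by rewrite -prime_coprime // !coprimeMr cqn.
have radK : rad K = rad n.
  apply: eq_rad => p; rewrite !primesM ?muln_gt0 ?n0 // orbA orbb primes_part mem_filter.
  by rewrite -[p \in \pi(n)]/(p \in primes n); case: (p \in primes n).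
have KrK : K %/ rad K = n * D * (n %/ rad n).
  rewrite radK {1}/K mulnC -{2}(divnK (rad_dvd _ n0)) mulnA mulnK //.
(* For even [n], 4 divides [n * n]; for odd [n], all of [n], [D] and [q] are odd. The division by
   [e] in q - 1 thus compensates delta. *)
have dK : delta (K * q) = e.
  rewrite /delta /e; case: (boolP (odd n)) => [on|en2]; last first.
    have d4 : 4 %| n * n by rewrite -[4]/(2 * 2) dvdn_mul ?dvdn2.
    by rewrite ifT // /K [n * (n * D)]mulnA -mulnA dvdn_mulr.
  rewrite ifF //; apply/negbTE/negP => /(dvdn_trans (isT : 2 %| 4)).
  rewrite dvdn2 !oddM on /=.
  have -> : odd q by case: (even_prime pq) q2 => [->|].
  rewrite andbT => /negP; apply; apply/negPn.
  rewrite -dvdn2; apply/negP => d2.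
  have : 2 \in primes D by rewrite mem_primes D0 d2.
  rewrite primes_part mem_filter => /andP[+ _]; rewrite -[2 \in \pi(n)]/(2 \in primes n).
  by rewrite mem_primes dvdn2 on !andbF.
have ene : e * (n %/ e) = n by rewrite mulnC divnK.
have -> : dfun (K * q) = K.
  apply: (@dfun_eq _ _ _ 1 (totient (rad n) * (n %/ rad n) * D * u)) => //.
  - by rewrite muln1.
  - transitivity (e * (n %/ e) * n * totient (rad n) * (n %/ rad n) * D ^ 2 * u).
      by rewrite radK dK eq_q; lia.
    by rewrite ene /K; lia.
  by rewrite mul1n !coprimeMr cqt cqr cqD.
congr (_ * _); apply/esym.
(* In phi(K) = D * D' * n * D * (n / rad n), every factor but [D'] is already found in q - 1. *)
apply: (@ffun_eq _ _ _ n u D') => //.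
- by rewrite /K mulnC.
- transitivity (e * (n %/ e) * n * (n %/ rad n) * D ^ 2 * u).
    by rewrite dK eq_q; lia.
  by rewrite ene KrK; lia.
- move=> a; apply: expn_totient_dvd.
  rewrite (totient_rad_div K) // KrK radK -DD' eq_q.
  by apply/dvdnP; exists ((n %/ e) * u); lia.
by rewrite coprimeMl !coprimeMr cnu cnD' cqu.
Qed.

(** * Linnik's bound with exact valuations of q - 1 *)

Lemma coprime_rad k x : 0 < k -> 0 < x -> coprime k x = coprime (rad k) x.
Proof. by move=> k0 x0; rewrite !coprime_has_primes ?rad_gt0 // primes_rad. Qed.

Lemma INR_leq m n : m <= n -> Rle (INR m) (INR n).
Proof. by move=> /leP; exact: le_INR. Qed.

Lemma INR_muln m n : INR (m * n) = Rmult (INR m) (INR n).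
Proof. exact: mult_INR. Qed.

Lemma INR_gt0 n : 0 < n -> Rlt 0 (INR n).
Proof. by move=> /ltP; exact: lt_0_INR. Qed.

Lemma INR_expn b N : 0 < b -> INR (b ^ N) = Rpower (INR b) (INR N).
Proof.
move=> b0; rewrite Rpower_pow; last exact: INR_gt0.
by elim: N => [|N IH] //; rewrite expnS INR_muln IH.
Qed.

Lemma Rpower_INR_mono b x y : 0 < b -> Rle x y ->
  Rle (Rpower (INR b) x) (Rpower (INR b) y).
Proof.
move=> b0 xy; case: b b0 => // -[_|b _].
  by rewrite /Rpower ln_1 !Rmult_0_r; apply: Rle_refl.
apply: Rle_Rpower xy; have := INR_leq 1 b.+2 isT; rewrite /=; lra.
Qed.

Definition linnik_bound (c L : R) : Prop :=
  forall a q : nat, 1 <= a -> a < q -> coprime a q ->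
    exists p j : nat, prime p /\ p = a + j * q /\
      Rle (INR p) (Rmult c (Rpower (INR q) L)).

(** The residue 1 + T modulo T * Q gives q - 1 = T * (1 + j * Q); since [Q] divides [T], this
    residue is coprime to the modulus. *)
Lemma linnik_exact c L T Q : linnik_bound c L -> 1 < T -> 0 < Q -> Q %| T ->
  exists q u, [/\ prime q, q.-1 = T * u, coprime Q u &
    Rle (INR q) (Rmult c (Rpower (INR (T * Q)) L))].
Proof.
move=> linnik T1 Q0 QT; have [Q1|Q1] := leqP Q 1.
  have [|p [j [pp [ep bp]]]] := linnik 1 T isT T1; first by rewrite coprime1n.
  have -> : Q = 1 by lia.
  by exists p, j; split; rewrite ?coprime1n ?muln1 // ep; lia.
have [||p [j [pp [ep bp]]]] := linnik T.+1 (T * Q) isT; first by nia.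
  rewrite coprimeMr coprimeSn /=.
  by apply: coprime_dvdr QT _; rewrite coprimeSn.
exists p, (1 + j * Q); split=> //; first by rewrite ep; lia.
by rewrite addnC /coprime gcdnMDl gcdn1.
Qed.

Lemma Rle_mul_linnik c L X Y q B B' : Rlt 0 L -> Rlt 0 c -> 0 < B -> X <= Y ->
    B <= B' -> Rle (INR q) (Rmult c (Rpower (INR B) L)) ->
  Rle (INR (X * q)) (Rmult c (Rmult (INR Y) (Rpower (INR B') L))).
Proof.
move=> L0 c0 B0 XY BB' hq; rewrite INR_muln.
have pB : Rle (Rpower (INR B) L) (Rpower (INR B') L).
  by apply: Rle_Rpower_l; [lra | split; [exact: INR_gt0 | exact: INR_leq]].
have hq' : Rle (INR q) (Rmult c (Rpower (INR B') L)).
  by apply: Rle_trans hq _; apply: Rmult_le_compat_l => //; lra.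
have -> : Rmult c (Rmult (INR Y) (Rpower (INR B') L)) =
          Rmult (INR Y) (Rmult c (Rpower (INR B') L)) by ring.
by apply: Rmult_le_compat => //; [exact: pos_INR | exact: pos_INR | exact: INR_leq].
Qed.

(** * Existence of m of explicit size, and the special value m = 8 *)

Lemma dfun1 : dfun 1 = 1.
Proof. by rewrite /dfun gcd1n. Qed.

Lemma ffun1 : ffun 1 = 1.
Proof. by rewrite /ffun gcd1n. Qed.

Lemma exists_dfun_ffun_odd c L a k : Rlt 0 L -> Rlt 0 c -> linnik_bound c L ->
    0 < a -> odd k -> coprime k (a * totient (rad (a * k))) -> 1 < a * k ->
  exists m, [/\ 0 < m, dfun m = a * k, ffun m = a &
    Rle (INR m) (Rmult c (Rmult (INR (a * k * k))
                                (Rpower (INR ((a * k) ^ 2)) L)))].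
Proof.
move=> L0 c0 linnik a0 ok cop ak; have k0 : 0 < k by case: (k) ok.
have rk := rad_leq _ k0.
have T1 : 1 < a ^ 2 * k by nia.
have [|q [u [pq eq_q cu bq]]] := linnik_exact _ _ (a ^ 2 * k) (rad k) linnik T1 (rad_gt0 k).
  by rewrite dvdn_mull ?rad_dvd.
have u0 : 0 < u by have := prime_gt1 pq; case: (u) eq_q; lia.
have q2 : 2 < q.
  by apply: leq_ltn_trans T1 _; apply: (dvdn_pred_lt _ _ pq); rewrite eq_q dvdn_mulr.
have [] := dfun_ffun_mul a k q u pq q2 a0 ok cop eq_q; first by rewrite coprime_rad.
move=> dm fm; exists (a * (k * rad k) * q); split=> //.
  by rewrite !muln_gt0 a0 k0 rad_gt0 prime_gt0.
apply: Rle_mul_linnik bq => //; first by rewrite muln_gt0 rad_gt0 (ltnW T1).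
  by rewrite mulnA leq_mul2l rk orbT.
(* The modulus is a^2 * k * rad k, at most (a * k)^2. *)
by rewrite expnMn -[k ^ 2]mulnn mulnA leq_mul2l rk orbT.
Qed.

Lemma exists_dfun_eq_mul_ffun c L n : Rlt 0 L -> Rlt 0 c -> linnik_bound c L ->
    1 < n ->
  exists m, [/\ 0 < m, dfun m = n * ffun m &
    Rle (INR m) (Rmult c (Rmult (INR (n ^ 3)) (Rpower (INR (n ^ 5)) L)))].
Proof.
move=> L0 c0 linnik n1; have n0 := ltnW n1.
have rn := rad_leq _ n0; have r0 := rad_gt0 n; have tr := totient_leq (rad n).
pose D := (totient (rad n))`_\pi(n); pose e := if odd n then 1 else 2.
have D0 : 0 < D by exact: part_gt0.
have Dn : D <= n.
  apply: leq_trans rn; apply: leq_trans tr.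
  by rewrite dvdn_leq ?totient_gt0 ?r0 // dvdn_part.
have en : e %| n by rewrite /e; case: ifP => // /negbT; rewrite dvdn2.
have ne0 : 0 < n %/ e by rewrite divn_gt0 ?(dvdn_leq n0) // /e; case: ifP.
have nr0 : 0 < n %/ rad n by rewrite divn_gt0 ?(dvdn_leq n0) ?rad_dvd.
pose T := n * (n %/ e) * (n %/ rad n) * D ^ 2.
have nT : n %| T by rewrite /T -!mulnA dvdn_mulr.
have T0 : 0 < T by rewrite !muln_gt0 n0 ne0 nr0 D0.
have T1 : 1 < T by apply: leq_trans n1 _; rewrite dvdn_leq.
have [|q [u [pq eq_q cu bq]]] := linnik_exact _ _ T (rad n) linnik T1 r0.
  by apply: dvdn_trans nT; exact: rad_dvd.
have u0 : 0 < u by have := prime_gt1 pq; case: (u) eq_q; lia.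
exists (n * (n * D) * q); split.
- by rewrite !muln_gt0 n0 D0 prime_gt0.
- by apply: (dfun_eq_mul_ffun n q u) => //; rewrite coprime_rad.
apply: Rle_mul_linnik bq => //; first by rewrite muln_gt0 T0.
  by rewrite !expnS expn0 muln1 !leq_mul2l Dn !orbT.
(* The factor rad n of the modulus is absorbed by n / rad n, which keeps the modulus below n^5. *)
have -> : T * rad n = n * (n %/ e) * n * D ^ 2.
  transitivity (n * (n %/ e) * (n %/ rad n * rad n) * D ^ 2); first by rewrite /T; lia.
  by rewrite divnK ?rad_dvd.
rewrite (_ : n ^ 5 = n * n * n * n ^ 2); last by lia.
rewrite leq_mul ?leq_exp2r // leq_mul2r leq_mul2l leq_div !orbT //.
Qed.

Lemma exists_dfun_ffun_pow2 c L i : Rlt 0 L -> Rlt 0 c -> linnik_bound c L ->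
  exists m, [/\ 0 < m, dfun m = 2 ^ i.+2, ffun m = 1 &
    Rle (INR m) (Rmult c (Rmult (INR (2 * 2 ^ i.+2)) (Rpower (INR (2 ^ i.+2)) L)))].
Proof.
move=> L0 c0 linnik.
have T1 : 1 < 2 ^ i.+1 by rewrite -{1}(expn0 2) ltn_exp2l.
have [|q [u [pq eq_q cu bq]]] := linnik_exact _ _ (2 ^ i.+1) 2 linnik T1 isT.
  by rewrite expnS dvdn_mulr.
rewrite coprime2n in cu.
have [dm fm] := dfun_ffun_pow2 i q u pq cu eq_q.
exists (2 ^ i.+3 * q); split=> //; first by rewrite muln_gt0 expn_gt0 (prime_gt0 pq).
by apply: Rle_mul_linnik bq => //; rewrite -?expnS -?expnSr ?expn_gt0.
Qed.

(** Coprimality to the even number b / a makes [a] and phi(rad b) odd, while an odd prime p dividing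
    [b] would put the even factor p - 1 into phi(rad b). *)
Lemma even_cofactor a b : 0 < a -> 0 < b -> a %| b ->
    coprime (b %/ a) (a * totient (rad b)) -> ~~ odd (b %/ a) ->
  a = 1 /\ exists j, b = 2 ^ j.+1.
Proof.
move=> a0 b0 ab cop ek; have k2 : 2 %| b %/ a by rewrite dvdn2.
move: cop => /(coprime_dvdl k2); rewrite coprimeMr !coprime2n => /andP[oa ot].
have pb : 2.-nat b.
  apply/pnatP => // p pp pb; have := even_prime pp => -[-> //|op].
  have p2 : 2 %| p.-1 by rewrite dvdn2; case: (p) (prime_gt0 pp) op.
  have pm : p \in primes b by rewrite mem_primes pp b0.
  by have := dvdn_trans p2 (pred_dvd_totient_rad _ _ pm); rewrite dvdn2 ot.
have pa : 2.-nat a by exact: pnat_dvd pb.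
have [i ei] := p_natP pa; have [j ej] := p_natP pb.
have a1 : a = 1 by case: i ei oa => [|i] -> //; rewrite oddX.
split=> //; case: j ej => [|j ->]; last by exists j.
by move=> b1; move: k2; rewrite a1 b1.
Qed.

Lemma dfun8 : dfun 8 = 2.
Proof. by rewrite /dfun /rad -[primes 8]/[:: 2] big_seq1. Qed.

Lemma carmichael8 : carmichael 8 = 2.
Proof.
have [l0 /(carm_propP 8 _ isT) h lmin] := carmichaelP 8 isT.
apply/eqP; rewrite eqn_leq lmin //=; last first.
  apply/carm_propP => // a; rewrite coprime_sym -[8]/(2 ^ 3) coprime_pexpl //.
  rewrite coprime2n; exact: (expn_odd_mod2 0).
(* The exponent 1 is ruled out by the unit 3. *)
by case: (carmichael 8) l0 h => // -[|//] _ /(_ 3 isT).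
Qed.

Lemma ffun8 : ffun 8 = 1.
Proof.
rewrite /ffun carmichael8 /rad -[primes 8]/[:: 2] big_seq1.
by rewrite -[8]/(2 ^ 3) totient_pfactor.
Qed.

(** * The three bounds with a common constant *)

Theorem theorem1p3 (L : R) : linnik_constant L ->
  exists C : R, Rlt 0 C /\
  (forall n : nat, 0 < n -> exists m : nat, 0 < m /\
      Rle (INR m) (Rmult C (Rpower (INR n) (Rplus (Rmult 2 L) 1))) /\
      dfun m = n /\ ffun m = n) /\
  (forall n : nat, 0 < n -> exists m : nat, 0 < m /\
      Rle (INR m) (Rmult C (Rpower (INR n) (Rplus (Rmult 6 L) 3))) /\
      dfun m = n * ffun m) /\
  (forall a b : nat, 0 < a -> 0 < b -> a %| b ->
      coprime (b %/ a) (a * totient (rad b)) ->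
      exists m : nat, 0 < m /\
      Rle (INR m) (Rdiv (Rmult C (Rpower (INR b) (Rplus (Rmult 2 L) 2))) (INR a)) /\
      ffun m = a /\ dfun m = b).
Proof.
case=> L0 [c [c0 linnik]].
have pos b x : Rlt 0 (Rpower (INR b) x) by exact: exp_pos.
have ge1 b x : 0 < b -> Rle 0 x -> Rle 1 (Rpower (INR b) x).
  by move=> b0 x0; rewrite -(Rpower_O (INR b)); [exact: Rpower_INR_mono | exact: INR_gt0].
(* The summand 8 pays for m = 8 (when b = 2), the factor 2 for the other powers of 2. *)
exists (Rplus (Rmult 2 c) 8); split; first lra.
have Cc x y : Rle 0 y -> Rle x (Rmult c y) -> Rle x (Rmult (Rplus (Rmult 2 c) 8) y).
  by move=> y0; nra.
have C1 y : Rle 1 y -> Rle 1 (Rmult (Rplus (Rmult 2 c) 8) y) by nra.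
have part1 n : 0 < n -> exists m : nat, 0 < m /\
    Rle (INR m) (Rmult (Rplus (Rmult 2 c) 8) (Rpower (INR n) (Rplus (Rmult 2 L) 1))) /\
    dfun m = n /\ ffun m = n.
  (* For n = 1 the prescribed divisor of q - 1 would be 1, outside the range of [linnik_exact]; m =
     1 serves. *)
  move=> n0; have [n1|n1] := leqP n 1.
    have -> : n = 1 by lia.
    exists 1; rewrite dfun1 ffun1; do !split=> //.
    by apply/C1/ge1 => //; lra.
  have [||m [m0 dm fm bm]] := exists_dfun_ffun_odd c L n 1 L0 c0 linnik n0 isT.
  - by rewrite coprime1n.
  - by rewrite muln1.
  move: bm dm; rewrite !muln1 INR_expn // Rpower_mult => bm dm.
  exists m; do !split=> //; apply: Cc; first exact/Rlt_le/pos.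
  rewrite Rpower_plus Rpower_1; last exact: INR_gt0.
  by rewrite [X in Rmult c X]Rmult_comm in bm.
split; first exact: part1.
split=> [n n0|a b a0 b0 ab cop].
  have [n1|n1] := leqP n 1.
    have -> : n = 1 by lia.
    exists 1; rewrite dfun1 ffun1; do !split=> //.
    by apply/C1/ge1 => //; lra.
  have [m [m0 dm bm]] := exists_dfun_eq_mul_ffun c L n L0 c0 linnik n1.
  exists m; do !split=> //; apply: Cc; first exact/Rlt_le/pos.
  apply: Rle_trans bm _; apply: Rmult_le_compat_l; first lra.
  (* The construction gives the exponent 5L + 3, at most 6L + 3. *)
  rewrite !INR_expn // Rpower_mult -Rpower_plus; apply: Rpower_INR_mono => //.
  rewrite !S_INR /=; lra.
have a0' := INR_gt0 a a0; have b0' := INR_gt0 b b0.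
have divC x y z : Rle (Rmult x (INR a)) (Rmult y z) -> Rle x (Rdiv (Rmult y z) (INR a)).
  move=> h; apply: (Rmult_le_reg_r (INR a)) => //.
  by rewrite /Rdiv Rmult_assoc Rinv_l ?Rmult_1_r //; apply: Rgt_not_eq.
have [ok|ek] := boolP (odd (b %/ a)); last first.
  have [a1 [j bj]] := even_cofactor a b a0 b0 ab cop ek.
  rewrite a1 /Rdiv Rinv_1 Rmult_1_r.
  (* For b = 2 the general recipe would take q - 1 odd with K = 4, which is impossible; hence m =
     8. *)
  case: j bj => [|j] bj.
    exists 8; rewrite dfun8 ffun8 bj; do !split=> //.
    have := ge1 2 (Rplus (Rmult 2 L) 2) isT; rewrite /=; nra.
  have [m [m0 dm fm bm]] := exists_dfun_ffun_pow2 c L j L0 c0 linnik.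
  move: bm dm; rewrite -bj => bm dm; exists m; do !split=> //.
  have hb : Rle (Rmult (INR b) (Rpower (INR b) L)) (Rpower (INR b) (Rplus (Rmult 2 L) 2)).
    rewrite -{1}(Rpower_1 _ b0') -Rpower_plus; apply: Rpower_INR_mono => //; lra.
  apply: Rle_trans bm _; rewrite INR_muln /= Rmult_assoc.
  have := Rmult_le_compat_l _ _ _ (Rlt_le _ _ c0) hb.
  have := pos b (Rplus (Rmult 2 L) 2); lra.
have [b1|b1] := leqP b 1.
  have eb : b = 1 by lia.
  have ea : a = 1 by apply/eqP; rewrite -dvdn1 -eb.
  rewrite ea eb /Rdiv Rinv_1 Rmult_1_r; exists 1; rewrite dfun1 ffun1; do !split=> //.
  by apply/C1/ge1 => //; lra.
have akb : a * (b %/ a) = b by rewrite mulnC divnK.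
have [||m [m0 dm fm bm]] := exists_dfun_ffun_odd c L a (b %/ a) L0 c0 linnik a0 ok.
- by rewrite akb.
- by rewrite akb.
move: dm bm; rewrite akb INR_expn // Rpower_mult => dm bm.
exists m; do !split=> //; apply: divC; apply: Cc; first exact/Rlt_le/pos.
apply: Rle_trans (Rmult_le_compat_r _ _ _ (Rlt_le _ _ a0') bm) _.
(* With k = b / a, the product of [a] and a * k * k is b^2, so the two sides are equal. *)
apply: Req_le; have kb : Rmult (INR a) (INR (b %/ a)) = INR b by rewrite -INR_muln akb.
have -> : Rplus (Rmult 2 L) 2 = Rplus (Rmult (INR 2) L) (Rplus 1 1) by rewrite /=; ring.
rewrite !Rpower_plus !Rpower_1 // INR_muln; set P := Rpower _ _.
transitivity (Rmult (Rmult c P) (Rmult (INR b) (Rmult (INR a) (INR (b %/ a))))); first ring.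
by rewrite kb; ring.
Qed.
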